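(* Consider the auction with $N$ users and $M$ resources split into $G$ groups described in the context. $(p^*,c^* )$ is an optimal mechanism (i.e. one maximizing the service provider's total revenue $\sum_{i=1}^{N}\mathbb{E}_{t_i}\{c_i(t_i)\}$) if $p^*$ maximizes $$\sum_{i=1}^{N}\mathbb{E}_{\mathbf{t}}\Big\{\sum_{j=1}^{M}\Big(v_{ij}(t_i,\mathbf{t}_{-i})-\frac{1-F(t_i)}{f(t_i)}\frac{\partial v_{ij}(t_i,\mathbf{t}_{-i})}{\partial t_i}\Big)p_{ij}(t_i,\mathbf{t}_{-i})+S_i(t_i,\mathbf{t}_{-i})\Big\}$$ subject to the following three constraints, for every $i\in\{1,\dots,N\}$ and all $t_i,\hat t_i\in[\underline{t_i},\overline{t_i}]$: (1) $u_i(\underline{t_i})\ge 0$; (2) $u_i(t_i)=u_i(\underline{t_i})+\mathbb{E}_{\mathbf{t}_{-i}}\Big\{\sum_{j=1}^{M}\int_{\underline{t_i}}^{t_i}\frac{\partial v_{ij}(x,\mathbf{t}_{-i})}{\partial t_i}\,p_{ij}(x,\mathbf{t}_{-i})\,dx\Big\}$; (3) $\mathbb{E}_{\mathbf{t}_{-i}}\Big\{\sum_{j=1}^{M}\int_{\hat t_i}^{t_i}\frac{\partial v_{ij}(x,\mathbf{t}_{-i})}{\partial t_i}\,p_{ij}(x,\mathbf{t}_{-i})\,dx\Big\}\ge \mathbb{E}_{\mathbf{t}_{-i}}\Big\{\sum_{j=1}^{M}\big(v_{ij}(t_i,\mathbf{t}_{-i})-v_{ij}(\hat t_i,\mathbf{t}_{-i})\big)p_{ij}(\hat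 t_i,\mathbf{t}_{-i})\Big\}$. To achieve the optimal revenue, the (maximum) cost $c_i^*(t_i)$ charged to each user $i$ can be obtained from $$c_i^*(t_i)=\mathbb{E}_{\mathbf{t}}\Big\{\sum_{j=1}^{M}p_{ij}^*(t_i,\mathbf{t}_{-i})v_{ij}(t_i,\mathbf{t}_{-i})-\sum_{j=1}^{M}\int_{\underline{t_i}}^{t_i}\frac{\partial v_{ij}(x,\mathbf{t}_{-i})}{\partial t_i}p_{ij}^*(x,\mathbf{t}_{-i})\,dx+S_i^*(t_i,\mathbf{t}_{-i})\Big\},$$ where $S_i^*$ is $S_i$ computed with $p=p^*$.
   Context: Setting. There are $N$ users (buyers) and one service provider (seller) with $M$ resources, divided into $G$ groups; group $k$ contains $M_k$ resources, $M_1+\dots+M_G=M$, and consists of the resources with indices $j$ from $\sum_{n=1}^{k-1}M_n+1$ to $\sum_{n=1}^{k}M_n$. Resources in the same group are substitutable and resources in different groups are complementary. User $i$ has a private type $t_i\in[\underline{t_i},\overline{t_i}]$, a random variable with CDF $F(t_i)$ and PDF $f(t_i)$ (which may differ from user to user), known to the service provider. Write $\mathbf{t}=(t_1,\dots,t_N)=(t_i,\mathbf{t}_{-i})$, where $\mathbf{t}_{-i}$ is the vector of types of the users other than $i$; $\mathbb{E}_{\mathbf{t}}$, $\mathbb{E}_{t_i}$, $\mathbb{E}_{\mathbf{t}_{-i}}$ denote expectations over $\mathbf{t}$, $t_i$, $\mathbf{t}_{-i}$. Valuations. $v_{ij}(t_i,\mathbf{t}_{-i})$ is the valuation of user $i$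 for resource $j$. It is assumed positive, non-decreasing and concave with respect to $t_i$; $\frac{\partial v_{ij}(x,\mathbf{t}_{-i})}{\partial t_i}$ denotes the partial derivative in the own-type argument evaluated at $t_i=x$. Mechanism. A mechanism is a pair $(p,c)$: $p$ is the set of all $p_{ij}$, where $p_{ij}(t_i,\mathbf{t}_{-i})$ is the proportion of resource $j$ allocated to user $i$ when the reported types are $(t_i,\mathbf{t}_{-i})$ (so $p_{ij}\ge 0$ and $\sum_{i=1}^N p_{ij}\le 1$ for each $j$), and $c=\{c_1,\dots,c_N\}$, where $c_i(t_i)$ is the cost charged by the service provider to user $i$. Premium and discount term. With premium factor $h_i(t_i)$ and discount factor $l_i(t_i)$ of user $i$, $$S_i(t_i,\mathbf{t}_{-i})=h_i(t_i)\prod_{k=1}^{G}\ \sum_{j=\sum_{n=1}^{k-1}M_n+1}^{\sum_{n=1}^{k}M_n}p_{ij}(t_i,\mathbf{t}_{-i})\;-\;l_i(t_i)\sum_{j=1}^{M}p_{ij}(t_i,\mathbf{t}_{-i}).$$ Utility. The expected utility of user $i$ of type $t_i$ under $(p,c)$, submitting true valuations, is $$u_i(t_i)=\mathbb{E}_{\mathbf{t}_{-i}}\Big\{\sum_{j=1}^{M}p_{ij}(t_i,\mathbf{t}_{-i})v_{ij}(t_i,\mathbf{t}_{-i})+S_i(t_i,\mathbf{t}_{-i})\Big\}-c_i(t_i).$$ The revenue of the service provider is the sum of the expected costs paid by the users, $\sum_{i=1}^{N}\mathbb{E}_{t_i}\{c_i(t_i)\}$. The three constraints in the claim are those by which the paper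 characterizes individually rational and incentive compatible (truthful) mechanisms, and revenue is maximized subject to them. *)

(* Defs.v *)
From HB Require Import structures.
From mathcomp Require Import all_boot all_order all_algebra.
From mathcomp Require Import all_classical all_reals all_analysis.

Set Implicit Arguments.
Unset Strict Implicit.
Unset Printing Implicit Defensive.

Import Order.TTheory GRing.Theory Num.Theory.
Import numFieldNormedType.Exports.

Local Open Scope classical_set_scope.
Local Open Scope ring_scope.

Section generalities.
Context {d : measure_display} {Omega : measurableType d} {R : realType}.

(* Every expectation taken below is finite under [standing] and [mechanism]. *)
Definition Ex (P : probability Omega R) (X : Omega -> R) : R :=
  fine ('E_P[X])%E.

(* For a finite family the product rule for subfamilies is the case where
   some of the [B i] are the whole line. *)
Definition mutually_independent (P : probability Omega R) (N : nat)
    (T : 'I_N -> {RV P >-> R}) : Prop :=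
  forall B : 'I_N -> set R, (forall i, measurable (B i)) ->
    P (\bigcap_(i in [set: 'I_N]) (T i @^-1` B i))
    = (\prod_(i < N) P (T i @^-1` B i))%E.

Definition has_pdf (P : probability Omega R) (X : {RV P >-> R}) (f : R -> R) :
    Prop :=
  [/\ measurable_fun [set: R] f,
      forall x, 0 <= f x &
      forall B : set R, measurable B ->
        distribution P X B = (\int[@lebesgue_measure R]_(x in B) (f x)%:E)%E].

End generalities.

Section real_functions.
Context {R : realType}.

(* Oriented: the bounds may come in either order. *)
Definition oint (a b : R) (g : R -> R) : R :=
  if a <= b then \int[@lebesgue_measure R]_(x in `[a, b]) g x
  else - \int[@lebesgue_measure R]_(x in `[b, a]) g x.

Definition concave_function (D : set R) (g : R -> R) : Prop :=
  @convex_function R R^o D (fun x => - g x).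

Definition upd {N : nat} (t : N.-tuple R) (i : 'I_N) (x : R) : N.-tuple R :=
  [tuple if k == i then x else tnth t k | k < N].

End real_functions.

(* [valuation i j t] is the valuation v_ij at the type profile t; only profiles
   in [box] below are meaningful. *)
Record auction d (Omega : measurableType d) (R : realType)
    (P : probability Omega R) (N M G : nat) := Auction {
  group_size : 'I_G -> nat;
  lo : 'I_N -> R;
  hi : 'I_N -> R;
  type_rv : 'I_N -> {RV P >-> R};
  pdf : 'I_N -> R -> R;
  valuation : 'I_N -> 'I_M -> N.-tuple R -> R;
  premium : 'I_N -> R -> R;
  discount : 'I_N -> R -> R }.

Section model.
Context {d : measure_display} {Omega : measurableType d} {R : realType}
  {P : probability Omega R} {N M G : nat}.
Variable A : auction P N M G.

Definition in_range (i : 'I_N) (x : R) : Prop := x \in `[lo A i, hi A i].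

Definition box : set (N.-tuple R) := [set t | forall i, in_range i (tnth t i)].

Definition profile (w : Omega) : N.-tuple R :=
  [tuple type_rv A k w | k < N].

Definition Et (g : N.-tuple R -> R) : R := Ex P (fun w => g (profile w)).

(* Expectation over the types of the users other than i, the type of user i
   being held at x. *)
Definition Eothers (i : 'I_N) (x : R) (g : N.-tuple R -> R) : R :=
  Ex P (fun w => g (upd (profile w) i x)).

Definition Eown (i : 'I_N) (g : R -> R) : R :=
  Ex P (fun w => g (type_rv A i w)).

Definition type_cdf (i : 'I_N) (x : R) : R := fine (cdf (type_rv A i) x).

(* Own-type partial derivative at t.  When t_i is an endpoint of its interval
   the value is irrelevant: the derivative only occurs inside integrals. *)
Definition dval (i : 'I_N) (j : 'I_M) (t : N.-tuple R) : R :=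
  derive1 (fun y : R => valuation A i j (upd t i y)) (tnth t i).

Record standing : Prop := {
  sum_group_size : M = (\sum_(k < G) group_size A k)%N;
  lo_lt_hi : forall i, lo A i < hi A i;
  type_in_range : forall i w, in_range i (type_rv A i w);
  type_indep : mutually_independent (type_rv A);
  type_pdf : forall i, has_pdf (type_rv A i) (pdf A i);
  (* so that the quotient (1 - F) / f is meaningful almost everywhere *)
  pdf_gt0 : forall i x, x \in `]lo A i, hi A i[ -> 0 < pdf A i x;
  valuation_gt0 : forall i j t, box t -> 0 < valuation A i j t;
  valuation_nondecreasing : forall i j t, box t ->
    {in `[lo A i, hi A i] &,
      {homo (fun x : R => valuation A i j (upd t i x)) : x y / x <= y}};
  valuation_concave : forall i j t, box t ->
    concave_function `[lo A i, hi A i]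
      (fun x : R => valuation A i j (upd t i x));
  valuation_derivable : forall i j t, box t ->
    forall x, x \in `]lo A i, hi A i[ ->
    derivable (fun y : R => valuation A i j (upd t i y)) x 1;
  valuation_measurable : forall i j, measurable_fun box (valuation A i j);
  valuation_integrable : forall i j x, in_range i x ->
    P.-integrable [set: Omega]
      (fun w => (valuation A i j (upd (profile w) i x))%:E);
  premium_measurable : forall i,
    measurable_fun `[lo A i, hi A i] (premium A i);
  discount_measurable : forall i,
    measurable_fun `[lo A i, hi A i] (discount A i);
  premium_integrable : forall i,
    P.-integrable [set: Omega] (fun w => (premium A i (type_rv A i w))%:E);
  discount_integrable : forall i,
    P.-integrable [set: Omega] (fun w => (discount A i (type_rv A i w))%:E) }.

Definition allocation := 'I_N -> 'I_M -> N.-tuple R -> R.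
Definition costs := 'I_N -> R -> R.

Record mechanism (p : allocation) (c : costs) : Prop := {
  alloc_ge0 : forall i j t, box t -> 0 <= p i j t;
  alloc_le1 : forall j t, box t -> \sum_(i < N) p i j t <= 1;
  alloc_measurable : forall i j, measurable_fun box (p i j);
  cost_integrable : forall i,
    P.-integrable [set: Omega] (fun w => (c i (type_rv A i w))%:E) }.

(* 0-based: group k is the block of resources of indices j with
   M_0 + ... + M_(k-1) <= j < M_0 + ... + M_k. *)
Definition in_group (k : 'I_G) (j : 'I_M) : bool :=
  (\sum_(n < G | n < k) group_size A n <= j
     < \sum_(n < G | n <= k) group_size A n)%N.

Definition premium_discount (p : allocation) (i : 'I_N) (t : N.-tuple R) : R :=
  premium A i (tnth t i)
    * (\prod_(k < G) \sum_(j < M | in_group k j) p i j t)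
  - discount A i (tnth t i) * (\sum_(j < M) p i j t).

Definition utility (p : allocation) (c : costs) (i : 'I_N) (x : R) : R :=
  Eothers i x (fun t =>
    (\sum_(j < M) p i j t * valuation A i j t) + premium_discount p i t)
  - c i x.

Definition revenue (c : costs) : R := \sum_(i < N) Eown i (c i).

Definition virtual_surplus (p : allocation) : R :=
  \sum_(i < N) Et (fun t =>
    (\sum_(j < M)
      (valuation A i j t
       - (1 - type_cdf i (tnth t i)) / pdf A i (tnth t i) * dval i j t)
      * p i j t)
    + premium_discount p i t).

(* The type t_i is overwritten by the integration variable x. *)
Definition rent (p : allocation) (i : 'I_N) (a b : R) (t : N.-tuple R) : R :=
  \sum_(j < M) oint a b (fun x => dval i j (upd t i x) * p i j (upd t i x)).

Record feasible (p : allocation) (c : costs) : Prop := {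
  feasible_mechanism : mechanism p c;
  feasible_participation : forall i, 0 <= utility p c i (lo A i);
  feasible_envelope : forall i x, in_range i x ->
    utility p c i x
    = utility p c i (lo A i) + Eothers i x (rent p i (lo A i) x);
  feasible_truthful : forall i x y, in_range i x -> in_range i y ->
    Eothers i x (fun t => \sum_(j < M)
        (valuation A i j (upd t i x) - valuation A i j (upd t i y))
        * p i j (upd t i y))
    <= Eothers i x (rent p i y x) }.

Definition optimal (p : allocation) (c : costs) : Prop :=
  feasible p c /\
  forall p' c', feasible p' c' -> revenue c' <= revenue c.

Definition maximizes_virtual_surplus (p : allocation) : Prop :=
  (exists c, feasible p c) /\
  forall p' c', feasible p' c' -> virtual_surplus p' <= virtual_surplus p.

Definition optimal_cost (p : allocation) : costs := fun i x =>
  Eothers i x (fun t =>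
    (\sum_(j < M) p i j t * valuation A i j t)
    - rent p i (lo A i) x t
    + premium_discount p i t).

End model.

(* Main.v *)
Require Import Defs.
From HB Require Import structures.
From mathcomp Require Import all_boot all_order all_algebra.
From mathcomp Require Import all_classical all_reals all_analysis.
From mathcomp Require Import measurable_realfun ring lra.
Import Order.TTheory GRing.Theory Num.Theory.
Import numFieldNormedType.Exports.
Local Open Scope classical_set_scope.
Local Open Scope ring_scope.

Set Implicit Arguments.
Unset Strict Implicit.
Unset Printing Implicit Defensive.

(** The envelope condition (2) forces c_i = optimal_cost_i - u_i(lo_i) for every
    feasible pair (p, c), so by (1) [optimal_cost] is the largest cost that
    implements p, and it is itself feasible because (3) does not involve c.
    It remains to see that its revenue is the virtual surplus of p.  By
    independence the profile has the same law as the profile in which t_i is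
    redrawn independently, so the expected gross utilities agree.  For the
    information rent, Tonelli and the density of t_i give
      E[int_lo^{t_i} m(y) dy] = int (1 - F(y)) m(y) dy
                              = E[(1 - F(t_i)) / f(t_i) m(t_i)],
    where m(y) is the expectation of the marginal rent at own type y.
    Everything is integrable because a concave nondecreasing valuation dominates
    the integral of its derivative. *)

(** * Integrals of functions that agree off a null set *)

Section null_sets.
Context d {T : measurableType d} {R : realType}.
Variable mu : {measure set T -> \bar R}.
Local Open Scope ereal_scope.

Import HBNNSimple.

Let sup_sintegral (f : T -> \bar R) := ereal_sup [set sintegral mu h |
  h in [set h : {nnsfun T >-> R} | forall x, (h x)%:E <= f x]].

(** A simple function below [f], multiplied by the indicator of the complement of [N], lies below
    [g], since [g] is nonnegative on [N], and keeps its integral. Exchanging [f] and [g] gives the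
    opposite inequality. *)
Let le_sup_sintegral (N : set T) (f g : T -> \bar R) :
  measurable N -> mu N = 0 -> (forall x, 0 <= g x) ->
  (forall x, ~ N x -> f x = g x) -> sup_sintegral f <= sup_sintegral g.
Proof.
move=> mN muN g0 fg; apply: ge_ereal_sup => _ [h /= hf <-].
pose h' := proj_nnsfun h (measurableC mN).
have -> : sintegral mu h = sintegral mu h'.
  rewrite -!integralT_nnsfun; apply: ae_eq_integral => //.
  - by apply/measurable_EFinP; exact: measurable_funP.
  - by apply/measurable_EFinP; exact: measurable_funP.
  - exists N; split=> // x /=; apply: contra_notP => Nx _.
    by rewrite mindicE mem_set// mulr1.
apply: ereal_sup_ubound; exists h' => // x /=.
rewrite mindicE; have [xN|xN] := pselect (N x).
  by rewrite memNset ?mulr0//; exact.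
by rewrite mem_set// mulr1 -fg.
Qed.

(* [f] need not be measurable: the integral is a supremum over simple functions,
   which may be cut off on [N].  This matters because [dval] is arbitrary at the
   endpoints of the type interval. *)
Lemma eq_integral_off_null (N D : set T) (f g : T -> \bar R) :
  measurable N -> mu N = 0 -> (forall x, ~ N x -> f x = g x) ->
  \int[mu]_(x in D) f x = \int[mu]_(x in D) g x.
Proof.
move=> mN muN fg; rewrite /integral.
have fgD x : ~ N x -> (f \_ D) x = (g \_ D) x.
  by move=> Nx; rewrite !patchE fg.
by congr (_ - _); apply/eqP; rewrite eq_le; apply/andP; split;
  apply: (le_sup_sintegral mN muN) => // x Nx;
  rewrite ?funeposE ?funenegE fgD.
Qed.

End null_sets.

(** * Derivatives of concave functions *)

Section concave.
Context {R : realType}.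
Implicit Types (a b : R) (v : R -> R).

(** Concavity with [t] written as a convex combination of [s] and [y]. Cross-multiplying the
    comparison of slopes avoids division, so that degenerate triples are covered as well. *)
Lemma concave_slope a b v s t y : concave_function `[a, b] v ->
  a <= s -> s <= t -> t <= y -> y <= b ->
  (v y - v t) * (t - s) <= (v t - v s) * (y - t).
Proof.
move=> cv as_ st ty yb.
have [sy|sy] := eqVneq s y.
  have -> : t = s by apply/le_anti; rewrite st sy ty.
  by rewrite -sy !subrr !mulr0.
have {sy}sy : 0 < y - s by rewrite subr_gt0 lt_neqAle sy (le_trans st).
pose l := (y - t) / (y - s).
have l0 : 0 <= l by rewrite divr_ge0 ?subr_ge0// ltW// -subr_gt0.
have l1 : l <= 1 by rewrite ler_pdivrMr// mul1r lerD2l lerN2.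
have := cv (Itv01 l0 l1) s y.
rewrite !inE/= !in_itv/= as_ yb (le_trans st (le_trans ty yb)).
rewrite (le_trans as_ (le_trans st ty)) => /(_ isT isT).
rewrite /conv/= /GRing.scale/= /conv/= /GRing.scale/= /unstable.onem.
have -> : l * s + (1 - l) * y = t by rewrite /l; field; rewrite gt_eqF.
rewrite -(ler_pM2r sy).
have -> : (l * - v s + (1 - l) * - v y) * (y - s) =
    - ((y - t) * v s + (t - s) * v y) by rewrite /l; field; rewrite gt_eqF.
by move=> h; nra.
Qed.

(* Increments tending to 0 that keep [x + eps_seq x b n] strictly below [b]. *)
Definition eps_seq (x b : R) : R ^nat := fun n => (b - x) / n.+2%:R.

Lemma eps_seqP x b : x < b -> (forall n, 0 < eps_seq x b n) /\
  (forall n, x + eps_seq x b n < b) /\ eps_seq x b n @[n --> \oo] --> 0.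
Proof.
rewrite -subr_gt0 => xb; split=> [n|]; first by rewrite divr_gt0.
split=> [n|].
  rewrite -ltrBrDl ltr_pdivrMr// ltr_pMr// (_ : 1 = 1%:R)// ltr_nat.
  by [].
rewrite -(mulr0 (b - x)); apply: cvgMr => //.
have := @cvg_harmonic R; rewrite -cvg_shiftS; exact.
Qed.

(** The sequential form of the derivative: it carries bounds on difference quotients over to
    [derive1], and later presents [dval] as a pointwise limit of measurable functions. *)
Lemma cvg_quotient v (x : R) (e : R ^nat) : derivable v x 1 ->
  (forall n, e n != 0) -> e n @[n --> \oo] --> 0 ->
  (e n)^-1 * (v (x + e n) - v x) @[n --> \oo] --> derive1 v x.
Proof.
move=> /cvg_ex[l vl] e0 ecvg.
rewrite derive1E /derive (cvg_lim _ vl)//.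
have /cvgr_dnbhsP/(_ e) := vl.
move=> /(_ (conj e0 ecvg)).
under eq_fun do rewrite /GRing.scale/= mulr1 [e _ + x]addrC.
exact.
Qed.

Lemma nondecreasing_derive1_ge0 a b v (x : R) :
  {in `[a, b] &, {homo v : s t / s <= t}} ->
  x \in `]a, b[ -> derivable v x 1 -> 0 <= derive1 v x.
Proof.
move=> vnd /[dup]; rewrite {1}in_itv/= => /andP[ax xb] xab vx.
have [] := eps_seqP xb => e_gt0 [e_lt ecvg].
have e0 n : eps_seq x b n != 0 by rewrite gt_eqF.
have q := cvg_quotient vx e0 ecvg.
rewrite -(cvg_lim _ q)//; apply: limr_ge; first by apply/cvg_ex; eexists; exact: q.
near=> n; rewrite mulr_ge0 ?invr_ge0 ?(ltW (e_gt0 n))// subr_ge0.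
apply: vnd; rewrite ?in_itv/= ?(ltW ax) ?(ltW xb)//=.
- by rewrite (ltW (e_lt n)) andbT ler_wpDr ?ltW.
- by rewrite lerDl ltW.
Unshelve. all: end_near. Qed.

(** For [y] to the right of [x], the slope over [[x, y]] is at most the slope over [[s, x]], which
    is at most the slope over [[s, t]]; then [y] tends to [x]. *)
Lemma concave_derive1_le a b v (s t x : R) : concave_function `[a, b] v ->
  a <= s -> s < t -> t <= x -> x < b -> derivable v x 1 ->
  derive1 v x <= (v t - v s) / (t - s).
Proof.
move=> cv as_ st tx xb vx.
have [] := eps_seqP xb => e_gt0 [e_lt ecvg].
have e0 n : eps_seq x b n != 0 by rewrite gt_eqF.
have q := cvg_quotient vx e0 ecvg.
rewrite -(cvg_lim _ q)//; apply: limr_le; first by apply/cvg_ex; eexists; exact: q.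
near=> n; rewrite mulrC ler_pdivrMr// mulrAC ler_pdivlMr ?subr_gt0//.
set y := x + _; have ynx : eps_seq x b n = y - x by rewrite /y addrAC subrr add0r.
have xy : x < y by rewrite -subr_gt0 -ynx.
have yb : y <= b by rewrite ltW// e_lt.
rewrite ynx.
have h1 := concave_slope cv as_ (ltW st) tx (le_trans (ltW xy) yb).
have h2 := concave_slope cv as_ (le_trans (ltW st) tx) (ltW xy) yb.
have [tx0|tx0] := eqVneq t x; first by rewrite {}tx0 in h2 *.
have {tx0}tx : t < x by rewrite lt_neqAle tx0.
rewrite -subr_gt0 in st; rewrite -subr_gt0 in tx; rewrite -subr_gt0 in xy.
have e1 : x - s = (x - t) + (t - s) by ring.
have e2 : v x - v s = (v x - v t) + (v t - v s) by ring.
(* The factor is [x - s], split at [t]: the slope over [[s, x]] is the weighted mean of the slopes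
   over [[s, t]] and [[t, x]]. *)
rewrite -(ler_pM2r (addr_gt0 tx st)).
rewrite e1 e2 in h2.
by nra.
Unshelve. all: end_near. Qed.

(* On each cell of the grid the derivative is at most the slope of [v] over the
   preceding cell, and these slopes telescope; continuity of the derivative is
   not needed. *)
Lemma integral_concave_grid a b v (h : R) (k : nat) : concave_function `[a, b] v ->
  {in `[a, b] &, {homo v : s t / s <= t}} ->
  {in `]a, b[, forall x, derivable v x 1} ->
  measurable_fun `]a, b[ (derive1 v) ->
  0 < h -> a + k.+1%:R * h <= b ->
  (\int[@lebesgue_measure R]_(x in `[(a + h)%R, (a + k.+1%:R * h)%R[) (derive1 v x)%:E
     <= (v (a + k%:R * h) - v a)%:E)%E.
Proof.
move=> cv vnd vd mv h0; elim: k => [|k IH] kb.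
  by rewrite mul1r set_itvco0 integral_set0 mul0r addr0 subrr.
have kb' : a + k.+1%:R * h <= b.
  by rewrite (le_trans _ kb)// lerD2l ler_pM2r// ler_nat.
have hk : a + h <= a + k.+1%:R * h.
  by rewrite lerD2l ler_peMl ?(ltW h0)// ler1n.
have kk : a + k.+1%:R * h <= a + k.+2%:R * h by rewrite lerD2l ler_pM2r// ler_nat.
have sub : `[a + h, a + k.+2%:R * h[ `<=` `]a, b[.
  move=> x /=; rewrite !in_itv/= => /andP[ax xb].
  by rewrite (lt_le_trans _ ax) ?ltrDl//= (lt_le_trans xb).
have mv' : measurable_fun `[a + h, a + k.+2%:R * h[ (EFin \o derive1 v).
  by apply/measurable_EFinP; apply: measurable_funS mv.
have e : `[a + h, a + k.+2%:R * h[%classic =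
    `[a + h, a + k.+1%:R * h[ `|` `[a + k.+1%:R * h, a + k.+2%:R * h[.
  by rewrite -itv_bndbnd_setU// bnd_simp.
have d0 x : `[a + h, a + k.+2%:R * h[%classic x -> (0 <= (derive1 v x)%:E)%E.
  move=> /sub xab; rewrite lee_fin.
  by apply: (nondecreasing_derive1_ge0 vnd) => //; exact: vd.
rewrite e in mv' d0 *.
rewrite ge0_integral_setU//; last first.
  rewrite disj_set2E; apply/eqP; rewrite -subset0 => x [] /=.
  by rewrite !in_itv/= => /andP[_ xk] /andP[kx _]; have := lt_le_trans xk kx; rewrite ltxx.
pose w := v (a + k.+1%:R * h); pose u := v (a + k%:R * h).
have -> : (w - v a)%:E = ((u - v a)%:E + (w - u)%:E)%E.
  by rewrite -EFinD; congr EFin; ring.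
apply: leeD; first exact: IH.
(* The increment over the preceding cell becomes the integral, over the last cell, of the constant
   slope [(w - u) / h]; the integrands can then be compared pointwise. *)
have -> : (w - u)%:E = (\int[@lebesgue_measure R]_(x in `[(a + k.+1%:R * h)%R, (a + k.+2%:R * h)%R[)
   ((w - u) / h)%:E)%E.
  rewrite integral_cst//= lebesgue_measure_itv/= lte_fin.
  have -> : (a + k.+1%:R * h < a + k.+2%:R * h) by rewrite ltrD2l ltr_pM2r// ltr_nat.
  rewrite -EFinB -EFinM; congr EFin.
  by rewrite -!natr1; field; rewrite gt_eqF.
apply: ge0_le_integral => //.
- by move=> x xk; apply: d0; right.
- by apply: measurable_funS mv'; [rewrite -e|move=> x xk; right].
- move=> x xk; rewrite lee_fin.
  have xab : x \in `]a, b[ by apply: (sub x); rewrite e; right.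
  have -> : h = (a + k.+1%:R * h) - (a + k%:R * h) by rewrite -!natr1; ring.
  move: xab (xk); rewrite /= !in_itv/= => /[dup] /andP[ax xb] xab /andP[kx _].
  apply: (concave_derive1_le cv) => //.
  + by rewrite lerDl mulr_ge0// ltW.
  + by rewrite ltrD2l ltr_pM2r// ltr_nat.
  + by apply: vd; rewrite in_itv/= ax.
Qed.

(** The grid bound for meshes [(b - a) / n.+1], followed by monotone convergence as the mesh
    shrinks. *)
Lemma integral_concave_derive1_le a b v : concave_function `[a, b] v ->
  {in `[a, b] &, {homo v : s t / s <= t}} ->
  {in `]a, b[, forall x, derivable v x 1} ->
  measurable_fun `]a, b[ (derive1 v) -> a < b ->
  (\int[@lebesgue_measure R]_(x in `]a, b[) (derive1 v x)%:E
     <= (v b - v a)%:E)%E.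
Proof.
move=> cv vnd vd mv ab.
have d0 x : `]a, b[%classic x -> (0 <= (derive1 v x)%:E)%E.
  move=> xab; rewrite lee_fin.
  by apply: (nondecreasing_derive1_ge0 vnd) => //; exact: vd.
pose h n := (b - a) / n.+1%:R : R.
have h0 n : 0 < h n by rewrite divr_gt0 ?subr_gt0.
(* The first cell is left out because the grid bound compares each cell with the one before it; the
   sets [F n] still exhaust the open interval. *)
pose F n := `[a + h n, b[%classic.
have FE : `]a, b[%classic = \bigcup_n F n.
  apply/seteqP; split=> [x /=|x [n _]]; last first.
    by rewrite /F/= !in_itv/= => /andP[ax ->]; rewrite (lt_le_trans _ ax)// ltrDl.
  rewrite in_itv/= => /andP[ax xb].
  have xa : 0 < (x - a) / (b - a) by rewrite divr_gt0 ?subr_gt0.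
  have [n _ hn] := near_infty_natSinv_lt (PosNum xa).
  have {}hn : n.+1%:R^-1 < (x - a) / (b - a) := hn n (leqnn n).
  exists n => //; rewrite /F/= in_itv/= xb andbT.
  by rewrite -lerBrDl /h mulrC -ler_pdivlMr ?subr_gt0// ltW.
have Fnd : {homo F : n m / (n <= m)%N >-> (n <= m)%O}.
  move=> n m nm; apply/subsetPset => x; rewrite /F/= !in_itv/= => /andP[ax ->].
  rewrite andbT (le_trans _ ax)// lerD2l ler_pM2l ?subr_gt0//.
  by rewrite lef_pV2 ?posrE// ler_nat.
have mF n : measurable (F n) by exact: measurable_itv.
have sub n : F n `<=` `]a, b[ by rewrite FE => x Fx; exists n.
have mvF n : measurable_fun (F n) (EFin \o derive1 v).
  by apply/measurable_EFinP; apply: measurable_funS mv.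
have := @ge0_nondecreasing_set_cvg_integral _ (measurableTypeR R) _ F (EFin \o derive1 v)
  lebesgue_measure Fnd mF mvF (fun n x Fx => d0 x (sub n x Fx)).
rewrite -FE => /cvg_lim <-//; apply: lime_le.
  apply: ereal_nondecreasing_is_cvgn => n m nm.
  apply: ge0_subset_integral => //.
  - exact: mF.
  - exact: mF.
  - exact: mvF.
  - by move=> x xF; exact: (d0 x (sub m x xF)).
  - by apply/subsetPset/Fnd.
near=> n.
have bE : b = a + n.+1%:R * h n by rewrite /h mulrC divfK ?pnatr_eq0// addrC subrK.
have kb : a + n.+1%:R * h n <= b by rewrite -bE.
have := integral_concave_grid cv vnd vd mv (h0 n) kb.
rewrite -bE => /le_trans; apply.
(* The grid bound stops at the last but one grid point, which monotonicity of [v] compares with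
   [b]. *)
rewrite lee_fin lerD2r; have nb : a + n%:R * h n <= b.
  by rewrite [leRHS]bE lerD2l ler_pM2r// ler_nat.
apply: vnd => //; rewrite in_itv/= ?lexx ?(ltW ab)//.
by rewrite nb lerDl mulr_ge0// ltW.
Unshelve. all: end_near. Qed.

End concave.

(** * Integration against a density *)

(** On nonnegative reals, 0 included, the inverse is the power of exponent -1, and powers are
    measurable. *)
Lemma ge0_measurable_funV d {T : measurableType d} {R : realType} (D : set T)
    (f : T -> R) : measurable_fun D f -> (forall x, D x -> 0 <= f x) ->
  measurable_fun D (fun x => (f x)^-1).
Proof.
move=> mf f0; apply: (eq_measurable_fun (fun x => f x `^ (-1))).
  by move=> x /[1!inE] /f0 fx; rewrite powRN powRr1.
exact: (measurableT_comp (measurable_powR _) mf).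
Qed.

Section density.
Context d {Omega : measurableType d} {R : realType} (P : probability Omega R).
Local Open Scope ereal_scope.

(* The density agrees almost everywhere with the Radon-Nikodym derivative. *)
Lemma ge0_integral_pdf (X : {RV P >-> R}) (f : R -> R) (g : R -> \bar R) :
  has_pdf X f -> measurable_fun [set: R] g -> (forall x, 0 <= g x) ->
  \int[P]_w g (X w) = \int[@lebesgue_measure R]_x (g x * (f x)%:E).
Proof.
move=> [mf f0 Xf] mg g0.
pose mu := @lebesgue_measure R.
have mX : measurable_fun [set: Omega] (X : Omega -> measurableTypeR R).
  exact: measurable_funP X.
(* [X] is repackaged with the measurable type that carries Lebesgue measure, so that its law can be
   compared with [mu]. *)
pose X' : {mfun Omega >-> measurableTypeR R} :=
  HB.pack (X : Omega -> measurableTypeR R)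
    (isMeasurableFun.Build _ _ _ _ _ mX).
pose nu : {finite_measure set (measurableTypeR R) -> \bar R} :=
  distribution P X'.
have nuE B : measurable B -> nu B = \int[mu]_(x in B) (f x)%:E by exact: Xf.
have numu : nu `<< mu.
  apply/null_content_dominatesP => A mA muA.
  rewrite nuE// null_set_integral//.
  by apply/measurable_EFinP; exact: measurable_funTS.
have mg' : measurable_fun [set: measurableTypeR R] g by exact: mg.
rewrite -[LHS](ge0_integral_distribution X' mg' g0) -/nu.
rewrite -(@Radon_Nikodym_SigmaFinite.change_of_variables _ _ _ nu mu)//.
have mrn := measurable_int _ (Radon_Nikodym_SigmaFinite.f_integrable numu).
apply: ae_eq_integral => //.
- exact: emeasurable_funM.
- by apply: emeasurable_funM => //; exact/measurable_EFinP.
- apply: ae_eqe_mul2l; apply: integral_ae_eq => //.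
  + exact: Radon_Nikodym_SigmaFinite.f_integrable.
  + exact/measurable_EFinP.
  + by move=> E _ mE; rewrite -Radon_Nikodym_SigmaFinite.f_integral// nuE.
Qed.

Lemma cdf_compl (X : {RV P >-> R}) (x : R) :
  P [set w | (x < X w)%R] = (1 - fine (cdf X x))%:E.
Proof.
have -> : [set w | (x < X w)%R] = ~` (X @^-1` `]-oo, x]).
  apply/seteqP; split=> w /=; rewrite in_itv/=; last by move/negP; rewrite ltNge.
  by move=> xX; apply/negP; rewrite -ltNge.
rewrite probability_setC; last first.
  by rewrite -[X in measurable X]setTI; exact: measurable_funP.
by rewrite EFinB fineK// fin_num_measure.
Qed.

(** Both integrals equal the Lebesgue integral of [M x] times the probability that [X] exceeds [x]:
    the left one by Tonelli on the region [x < X w], the right one because the density cancels the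
    denominator. Where the density may vanish, [M] is 0. *)
Lemma integral_survival_pdf (X : {RV P >-> R}) (f : R -> R) (a b : R)
    (M : R -> \bar R) : has_pdf X f ->
  (forall x, x \in `]a, b[ -> (0 < f x)%R) ->
  measurable_fun [set: R] M -> (forall x, 0 <= M x) ->
  (forall x, x \notin `]a, b[ -> M x = 0) ->
  measurable_fun [set: Omega]
    (fun w => \int[@lebesgue_measure R]_(x in `]-oo, X w[) M x) /\
  \int[P]_w \int[@lebesgue_measure R]_(x in `]-oo, X w[) M x =
  \int[P]_w (((1 - fine (cdf X (X w))) / f (X w))%:E * M (X w)).
Proof.
move=> Xf f_gt0 mM M0 Mout; have [mf f0 _] := Xf.
have F1 x : (0 <= 1 - fine (cdf X x))%R.
  by rewrite -lee_fin -cdf_compl measure_ge0.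
have mF : measurable_fun [set: R] (fun x => 1 - fine (cdf X x))%R.
  apply: measurable_funB => //; apply: measurableT_comp => //.
  exact: cdf_measurable.
rewrite (ge0_integral_pdf Xf
   (g := fun x => ((1 - fine (cdf X x)) / f x)%:E * M x)); last 2 first.
- apply: emeasurable_funM => //; apply/measurable_EFinP.
  apply: measurable_funM => //.
  exact: ge0_measurable_funV.
- by move=> x; rewrite mule_ge0// lee_fin divr_ge0.
pose k (z : Omega * measurableTypeR R) := (\1_[set z | z.2 < X z.1]%R z)%:E * M z.2.
have mXk : measurable [set z : Omega * measurableTypeR R | (z.2 < X z.1)%R].
  rewrite (_ : mkset _ = (fun z : Omega * measurableTypeR R => X z.1 - z.2)%R
      @^-1` `]0%R, +oo[); last first.
    by apply/seteqP; split=> z /=; rewrite in_itv/= andbT subr_gt0.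
  rewrite -[X in measurable X]setTI.
  have m2 : measurable_fun [set: Omega * measurableTypeR R]
    (fun z : Omega * measurableTypeR R => z.2 : R) by exact: measurable_snd.
  have m1 : measurable_fun [set: Omega * measurableTypeR R]
    (fun z : Omega * measurableTypeR R => X z.1) by exact: measurableT_comp.
  by apply: (measurable_funB m1 m2).
have mk : measurable_fun [set: Omega * measurableTypeR R] k.
  apply: emeasurable_funM; first exact/measurable_EFinP/measurable_indic.
  by apply: measurableT_comp => //.
have k0 z : 0 <= k z by rewrite mule_ge0// lee_fin.
have kE : (fun w => \int[@lebesgue_measure R]_(x in `]-oo, X w[) M x) =
    (fun w => \int[@lebesgue_measure R]_x k (w, x)).
  apply/funext => w; rewrite integral_mkcond; apply: eq_integral => x _.
  rewrite /k patchE indicE (_ : (_ \in mkset _) = (x \in `]-oo, X w[%classic)).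
    by case: ifPn; rewrite ?mul1e ?mul0e.
  by apply/idP/idP; rewrite !inE/= ?in_itv.
rewrite kE; split; first exact: measurable_fun_fubini_tonelli_F.
rewrite fubini_tonelli//; apply: eq_integral => x _.
transitivity (M x * P [set w | (x < X w)%R]).
  have mA : measurable (X @^-1` `]x, +oo[).
    by rewrite -[A in measurable A]setTI; exact: measurable_funP.
  have XE : [set w | (x < X w)%R] = X @^-1` `]x, +oo[.
    by apply/seteqP; split=> w /=; rewrite in_itv/= andbT.
  have kxE w : k (w, x) = (\1_(X @^-1` `]x, +oo[) w)%:E * M x.
    rewrite /k/= !indicE; congr ((_%:R)%:E * _).
    congr nat_of_bool; apply/idP/idP; rewrite !inE/= ?in_itv/= ?andbT; exact.
  under eq_integral do rewrite kxE.
  rewrite ge0_integralZr//; last exact/measurable_EFinP/measurable_indic.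
  by rewrite integral_indic// setIT XE muleC.
rewrite cdf_compl; have [xab|xab] := boolP (x \in `]a, b[); last first.
  by rewrite Mout// !(mul0e, mule0).
rewrite muleC -muleA (muleC (M x)) muleA -EFinM divfK// gt_eqF//.
exact: f_gt0.
Qed.

End density.

(** * Redrawing one coordinate of an independent profile *)

Section resampling.
Context d {Omega : measurableType d} {R : realType} (P : probability Omega R).
Variables (N : nat) (T : 'I_N -> {RV P >-> R}).

Definition rv_tuple (w : Omega) : N.-tuple R := [tuple T k w | k < N].

Lemma tnth_upd (t : N.-tuple R) i x k :
  tnth (upd t i x) k = if k == i then x else tnth t k.
Proof. by rewrite tnth_mktuple. Qed.

Lemma upd_upd (t : N.-tuple R) i x y : upd (upd t i x) i y = upd t i y.
Proof.
by apply: eq_from_tnth => k; rewrite !tnth_upd; case: (k == i).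
Qed.

Lemma upd_tnth (t : N.-tuple R) i : upd t i (tnth t i) = t.
Proof. by apply: eq_from_tnth => k; rewrite tnth_upd; case: eqP => [->|]. Qed.

Lemma measurable_upd d' (U : measurableType d') (t : U -> N.-tuple R) i
    (x : U -> R) :
  measurable_fun [set: U] t -> measurable_fun [set: U] x ->
  measurable_fun [set: U] (fun u => upd (t u) i (x u)).
Proof.
move=> mt mx; apply/measurable_fun_tnthP => k.
rewrite (_ : _ \o _ = fun u => if k == i then x u else tnth (t u) k).
  by case: (k == i) => //; exact: (measurableT_comp (measurable_tnth k) mt).
by apply/funext => u /=; rewrite tnth_upd.
Qed.

Lemma measurable_rv_tuple : measurable_fun [set: Omega] rv_tuple.
Proof.
apply/measurable_fun_tnthP => k.
rewrite (_ : _ \o _ = T k); first exact: measurable_funP.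
by apply/funext => w /=; rewrite tnth_mktuple.
Qed.

(** The first sample point supplies the type of user [i], the second all other types. Integrating
    over the second factor alone is thus an expectation over the others with the own type held
    fixed. *)
Definition resample (i : 'I_N) (z : Omega * Omega) : N.-tuple R :=
  upd (rv_tuple z.2) i (T i z.1).

Lemma measurable_resample i : measurable_fun [set: Omega * Omega] (resample i).
Proof.
apply: measurable_upd.
  exact: (measurableT_comp measurable_rv_tuple measurable_snd).
by apply: (measurableT_comp _ measurable_fst); exact: measurable_funP.
Qed.

Definition rectangle (B : 'I_N -> set R) : set (N.-tuple R) :=
  [set t | forall k, B k (tnth t k)].

Lemma measurable_rectangle B :
  (forall k, measurable (B k)) -> measurable (rectangle B).
Proof.
move=> mB.
rewrite (_ : rectangle B = \bigcap_(k in [set: 'I_N]) (@tnth N R ^~ k) @^-1` B k).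
  apply: fin_bigcap_measurable => // k _.
  by rewrite -[X in measurable X]setTI; exact: measurable_tnth.
by apply/seteqP; split=> [t h k _|t h k]; exact: h.
Qed.

(** Each generating coordinate cylinder is a rectangle whose other sides are the whole line.
    Rectangles, unlike these cylinders, are stable under intersection, as uniqueness of measures
    requires. *)
Lemma measurable_rectangles : @measurable _ (N.-tuple R) `<=`
  <<s [set rectangle B | B in [set B | forall k, measurable (B k)]] >>.
Proof.
apply: smallest_sub; first exact: smallest_sigma_algebra.
move=> A; rewrite -bigcup_seq => -[k _ [B mB <-]].
apply: sub_sigma_algebra.
exists (fun l => if l == k then B else setT).
  by move=> l; case: ifP.
rewrite setTI; apply/seteqP; split=> [t /(_ k)|t Bt l]; first by rewrite eqxx.
by case: eqP => [->|].
Qed.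

Hypothesis indep : mutually_independent T.

Lemma probability_rectangle (B : 'I_N -> set R) :
  (forall k, measurable (B k)) ->
  P (rv_tuple @^-1` rectangle B) = (\prod_(k < N) P (T k @^-1` B k))%E.
Proof.
move=> mB; rewrite -indep//; congr (P _).
by apply/seteqP; split=> w h k; [move=> _|];
  have := h k; rewrite ?tnth_mktuple//; exact.
Qed.

(** Two finite measures that agree on the rectangles are equal. On a rectangle, independence turns
    both into the product of the marginal probabilities. *)
Lemma resample_law i (E : set (N.-tuple R)) : measurable E ->
  P (rv_tuple @^-1` E) = (P \x P)%E (resample i @^-1` E).
Proof.
move=> /measurable_rectangles.
pose rv : {mfun Omega >-> N.-tuple R} :=
  HB.pack rv_tuple (isMeasurableFun.Build _ _ _ _ _ measurable_rv_tuple).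
pose rs : {mfun (Omega * Omega)%type >-> N.-tuple R} :=
  HB.pack (resample i) (isMeasurableFun.Build _ _ _ _ _ (measurable_resample i)).
have rT : rectangle (fun=> setT) = setT by apply/seteqP; split.
apply: (g_sigma_algebra_measure_unique _ _ (fun=> setT) _ _
   (pushforward P rv) (pushforward (P \x P)%E rs)).
- by move=> _ [B mB <-]; exact: measurable_rectangle.
- by move=> _; exists (fun=> setT).
- by apply/seteqP; split=> // t _; exists 0%N.
- move=> _ _ [B mB <-] [C mC <-]; exists (fun k => B k `&` C k).
    by move=> k; exact: measurableI.
  apply/seteqP; split=> [t h|t [h1 h2] k]; first by split=> k; case: (h k).
  by split.
- move=> _ [B mB <-].
  (* The second sample does not determine coordinate [i], so this side of the rectangle is freed. *)
  pose B' k := if k == i then setT else B k.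
  have mB' k : measurable (B' k) by rewrite /B'; case: (k == i).
  have mT (A : set R) : measurable A -> measurable (T i @^-1` A).
    by move=> mA; rewrite -[X in measurable X]setTI; exact: measurable_funP.
  have mrB : measurable (rv_tuple @^-1` rectangle B').
    rewrite -[X in measurable X]setTI; apply: measurable_rv_tuple => //.
    exact: measurable_rectangle.
  have rsE : resample i @^-1` rectangle B =
      (T i @^-1` B i) `*` (rv_tuple @^-1` rectangle B').
    apply/seteqP; split=> -[w w'] /=.
      move=> h; split.
        by have := h i; rewrite /= tnth_upd eqxx.
      move=> k; have := h k; rewrite /B' /= tnth_upd.
      by case: eqP.
    move=> [h1 h2] k; have := h2 k; rewrite /B' /= tnth_upd.
    by case: eqP => [->|].
  transitivity (\prod_(k < N) P (T k @^-1` B k))%E.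
    exact: probability_rectangle.
  transitivity ((P \x P)%E (resample i @^-1` rectangle B)); last by [].
  transitivity (P (T i @^-1` B i) * P (rv_tuple @^-1` rectangle B'))%E; last first.
    by rewrite rsE; apply/esym/product_measure1E => //; exact: mT.
  rewrite probability_rectangle// (bigD1 i)//= [in RHS](bigD1 i)//= /B' eqxx.
  rewrite preimage_setT probability_setT mul1e; congr (_ * _)%E.
  by apply: eq_bigr => k /negPf ->.
- by move=> _; apply: (le_lt_trans (probability_le1 P measurableT)); exact: ltry.
Qed.

Lemma ge0_integral_resample i (g : N.-tuple R -> \bar R) :
  measurable_fun [set: N.-tuple R] g -> (forall t, 0 <= g t)%E ->
  (\int[P]_w g (rv_tuple w) = \int[(P \x P)%E]_z g (resample i z))%E.
Proof.
move=> mg g0.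
have := ge0_integral_pushforward measurable_rv_tuple P measurableT mg
  (fun t _ => g0 t).
rewrite preimage_setT => <-.
have := ge0_integral_pushforward (measurable_resample i) (P \x P)%E measurableT mg
  (fun t _ => g0 t).
rewrite preimage_setT => <-.
pose rv : {mfun Omega >-> N.-tuple R} :=
  HB.pack rv_tuple (isMeasurableFun.Build _ _ _ _ _ measurable_rv_tuple).
pose rs : {mfun (Omega * Omega)%type >-> N.-tuple R} :=
  HB.pack (resample i) (isMeasurableFun.Build _ _ _ _ _ (measurable_resample i)).
apply: (@eq_measure_integral _ _ _ _ (pushforward (P \x P)%E rs) (pushforward P rv)).
by move=> A mA _; exact: resample_law.
Qed.

Lemma ge0_integral2_resample i (g : N.-tuple R -> \bar R) :
  measurable_fun [set: N.-tuple R] g -> (forall t, 0 <= g t)%E ->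
  (\int[P]_w g (rv_tuple w) =
   \int[P]_w \int[P]_w' g (upd (rv_tuple w') i (T i w)))%E.
Proof.
move=> mg g0; rewrite (ge0_integral_resample i mg g0).
apply: (fubini_tonelli1 (g \o resample i)); last by move=> z; exact: g0.
exact: (measurableT_comp mg (measurable_resample i)).
Qed.

(** Integrability passes to the product space through the absolute value of [g]. Fubini then
    applies, and the positive and negative parts reduce to the nonnegative case. *)
Lemma integral_resample i (g : N.-tuple R -> R) :
  measurable_fun [set: N.-tuple R] g ->
  P.-integrable [set: Omega] (fun w => (g (rv_tuple w))%:E) ->
  P.-integrable [set: Omega]
    (fun w => \int[P]_w' (g (upd (rv_tuple w') i (T i w)))%:E)%E /\
  (\int[P]_w (g (rv_tuple w))%:E =
   \int[P]_w \int[P]_w' (g (upd (rv_tuple w') i (T i w)))%:E)%E.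
Proof.
move=> mg ig; have mg' : measurable_fun [set: N.-tuple R] (EFin \o g).
  exact/measurable_EFinP.
have igr : (P \x P)%E.-integrable [set: Omega * Omega] (EFin \o g \o resample i).
  apply/integrableP; split.
    exact: (measurableT_comp mg' (measurable_resample i)).
  have := ge0_integral_resample i (measurableT_comp (@abse_measurable _ _) mg')
     (fun t => abse_ge0 _).
  rewrite /= => <-.
  by have /integrableP[] := ig.
split; first exact: (integrable_fubini_F igr).
rewrite (integral12_prod_meas1 igr).
have posE U (h : U -> N.-tuple R) :
    ((fun u => (g (h u))%:E)^\+ = (EFin \o g)^\+ \o h)%E.
  by apply/funext => u; rewrite /= !funeposE.
have negE U (h : U -> N.-tuple R) :
    ((fun u => (g (h u))%:E)^\- = (EFin \o g)^\- \o h)%E.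
  by apply/funext => u; rewrite /= !funenegE.
rewrite [LHS]integralE [RHS]integralE (posE _ rv_tuple) (negE _ rv_tuple).
rewrite (posE _ (resample i)) (negE _ (resample i)); congr (_ - _)%E.
  exact: (ge0_integral_resample i (measurable_funepos mg') (funepos_ge0 _)).
exact: (ge0_integral_resample i (measurable_funeneg mg') (funeneg_ge0 _)).
Qed.

End resampling.

(** * Linearity of real-valued expectations on integrable functions *)

Section expectation_linearity.
Context d {Omega : measurableType d} {R : realType} (P : probability Omega R).
Implicit Types f g : Omega -> R.

Local Notation L1fun f := (P.-integrable [set: Omega] (EFin \o f)).

Lemma ExE f : Ex P f = fine (\int[P]_w (f w)%:E)%E.
Proof. by rewrite /Ex unlock. Qed.

Lemma EFin_Ex f : L1fun f -> (Ex P f)%:E = (\int[P]_w (f w)%:E)%E.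
Proof. by move=> fi; rewrite ExE fineK//; exact: integrable_fin_num. Qed.

Lemma ExB f g : L1fun f -> L1fun g -> Ex P (f \- g) = Ex P f - Ex P g.
Proof.
move=> fi gi; apply/EFin_inj; rewrite EFinB !EFin_Ex//; last exact: (integrableB measurableT fi gi).
by rewrite -integralB.
Qed.

Lemma L1fun_sum (I : Type) (s : seq I) (f : I -> Omega -> R) :
  (forall i, L1fun (f i)) -> L1fun (fun w => \sum_(i <- s) f i w).
Proof.
move=> fi; rewrite (_ : _ \o _ = fun w => (\sum_(i <- s) (f i w)%:E)%E).
  by apply: (integrable_sum measurableT) => i _; exact: fi.
by apply/funext => w /=; rewrite -sumEFin.
Qed.

Lemma Ex_sum (I : Type) (s : seq I) (f : I -> Omega -> R) :
  (forall i, L1fun (f i)) ->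
  Ex P (fun w => \sum_(i <- s) f i w) = \sum_(i <- s) Ex P (f i).
Proof.
move=> fi; apply/EFin_inj; rewrite EFin_Ex; last exact: L1fun_sum.
under eq_integral do rewrite -sumEFin.
rewrite integral_sum// -sumEFin; apply: eq_bigr => i _; exact/esym/EFin_Ex.
Qed.

Lemma L1fun_mul_bounded f g (C : R) : L1fun f -> measurable_fun [set: Omega] g ->
  (forall w, `|g w| <= C) -> L1fun (f \* g).
Proof.
move=> fi mg gC.
have mf : measurable_fun [set: Omega] f.
  by apply/measurable_EFinP; exact: measurable_int fi.
apply: (le_integrable _ _ _ (integrableZl measurableT C fi)) => //.
  by apply/measurable_EFinP; exact: measurable_funM.
move=> w _ /=; rewrite lee_fin !normrM mulrC ler_wpM2r//.
exact: le_trans (gC w) (ler_norm _).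
Qed.

End expectation_linearity.

(** * Information rents *)

Section model.
Context d {Omega : measurableType d} {R : realType} {P : probability Omega R}
  {N M G : nat}.
Variables (A : auction P N M G) (SA : standing A).

Local Notation L1fun f := (P.-integrable [set: Omega] (EFin \o f)).

Lemma box_profile w : box A (profile A w).
Proof. by move=> i; rewrite tnth_mktuple; exact: type_in_range. Qed.

Lemma box_upd t i x : box A t -> in_range A i x -> box A (upd t i x).
Proof. by move=> bt ix k; rewrite tnth_upd; case: eqP => [->|_]. Qed.

Lemma measurable_box : measurable (box A).
Proof.
by apply: (measurable_rectangle (B := fun k => `[lo A k, hi A k]%classic)).
Qed.

Lemma measurable_profile : measurable_fun [set: Omega] (profile A).
Proof. exact: measurable_rv_tuple. Qed.

Lemma measurable_upd_profile i x :
  measurable_fun [set: Omega] (fun w => upd (profile A w) i x).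
Proof. exact: (measurable_upd i measurable_profile). Qed.

Lemma measurable_box_comp d' (U : measurableType d') (t : U -> N.-tuple R)
    (g : N.-tuple R -> R) : measurable_fun [set: U] t ->
  (forall u, box A (t u)) -> measurable_fun (box A) g ->
  measurable_fun [set: U] (fun u => g (t u)).
Proof.
move=> mt bt mg; apply: (measurable_comp measurable_box _ mg mt).
by move=> _ [u _ <-].
Qed.

Lemma lo_in_range i : in_range A i (lo A i).
Proof. by rewrite /in_range in_itv/= lexx ltW// (lo_lt_hi SA). Qed.

Lemma hi_in_range i : in_range A i (hi A i).
Proof. by rewrite /in_range in_itv/= lexx ltW// (lo_lt_hi SA). Qed.

(** * Bounds, measurability and integrability of gross utilities *)

Section allocation.
Variables (p : allocation (R := R) (N := N) (M := M)) (c : costs) (Hpc : mechanism A p c).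

Lemma alloc_le1_each i j t : box A t -> p i j t <= 1.
Proof.
move=> bt; apply: le_trans (alloc_le1 Hpc j bt).
rewrite (bigD1 i)//= lerDl sumr_ge0// => k _; exact: (alloc_ge0 Hpc).
Qed.

Definition gross_utility i t :=
  \sum_(j < M) p i j t * valuation A i j t + premium_discount A p i t.

Definition bundle i t := \prod_(k < G) \sum_(j < M | in_group A k j) p i j t.

(** Shares lie between 0 and 1, so the number of resources is a crude bound; it serves to make the
    premium and discount terms integrable. *)
Lemma sum_alloc_bound i (Q : pred 'I_M) t : box A t ->
  0 <= \sum_(j < M | Q j) p i j t <= M%:R.
Proof.
move=> bt; rewrite sumr_ge0/=; last by move=> j _; exact: (alloc_ge0 Hpc).
rewrite -[M in M%:R]card_ord -sum1_card natr_sum big_mkcond/= ler_sum// => j _.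
by case: ifP => _//; exact: alloc_le1_each.
Qed.

Lemma bundle_bound i t : box A t -> 0 <= bundle i t <= M%:R ^+ G.
Proof.
move=> bt; rewrite prodr_ge0/=; last first.
  by move=> k _; have /andP[] := sum_alloc_bound i (in_group A k) bt.
rewrite -[G in _ ^+ G]card_ord -prodr_const ler_prod// => k _.
exact: sum_alloc_bound.
Qed.

Lemma measurable_sum_alloc i (Q : pred 'I_M) :
  measurable_fun (box A) (fun t => \sum_(j < M | Q j) p i j t).
Proof.
under eq_fun do rewrite big_mkcond/=.
by apply: measurable_sum => j; case: (Q j) => //; exact: (alloc_measurable Hpc).
Qed.

Lemma measurable_bundle i : measurable_fun (box A) (bundle i).
Proof. by apply: measurable_prod => k _; exact: measurable_sum_alloc. Qed.

Lemma measurable_own_type i (h : R -> R) :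
  measurable_fun `[lo A i, hi A i] h ->
  measurable_fun (box A) (fun t => h (tnth t i)).
Proof.
move=> mh; apply: (measurable_comp _ _ mh) => //.
  by move=> _ [t bt <-]; exact: bt.
by apply: measurable_funTS; exact: measurable_tnth.
Qed.

Lemma measurable_gross_utility i : measurable_fun (box A) (gross_utility i).
Proof.
apply: measurable_funD.
  apply: measurable_sum => j; apply: measurable_funM.
    exact: (alloc_measurable Hpc).
  exact: (valuation_measurable SA).
apply: measurable_funB; apply: measurable_funM.
- exact: (measurable_own_type (premium_measurable SA (i := i))).
- exact: measurable_bundle.
- exact: (measurable_own_type (discount_measurable SA (i := i))).
- exact: measurable_sum_alloc.
Qed.

(** Each term is an integrable valuation, premium or discount times a bounded measurable factor. The
    random tuple [t] is left general to cover both the true profile and the profile with a fixed own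
    type. *)
Lemma L1fun_gross_utility i (t : Omega -> N.-tuple R) :
  measurable_fun [set: Omega] t -> (forall w, box A (t w)) ->
  (forall j, L1fun (fun w => valuation A i j (t w))) ->
  L1fun (fun w => premium A i (tnth (t w) i)) ->
  L1fun (fun w => discount A i (tnth (t w) i)) ->
  L1fun (fun w => gross_utility i (t w)).
Proof.
move=> mt bt vi hi li.
have vi' : L1fun (fun w => \sum_(j < M) p i j (t w) * valuation A i j (t w)).
  apply: L1fun_sum => j.
  rewrite (_ : (fun w => _) = (fun w => valuation A i j (t w)) \* (p i j \o t)).
    apply: (L1fun_mul_bounded (vi j) (C := 1)).
      exact: (measurable_box_comp mt bt (alloc_measurable Hpc i j)).
    by move=> w; rewrite ger0_norm ?alloc_le1_each//; exact: (alloc_ge0 Hpc).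
  by apply/funext => w; rewrite /= mulrC.
have hi' : L1fun ((fun w => premium A i (tnth (t w) i)) \* (bundle i \o t)).
  apply: (L1fun_mul_bounded hi (C := M%:R ^+ G)).
    exact: (measurable_box_comp mt bt (measurable_bundle i)).
  by move=> w; have /andP[b0 b1] := bundle_bound i (bt w); rewrite ger0_norm.
have li' : L1fun ((fun w => discount A i (tnth (t w) i)) \*
    ((fun t => \sum_(j < M) p i j t) \o t)).
  apply: (L1fun_mul_bounded li (C := M%:R)).
    exact: (measurable_box_comp mt bt (measurable_sum_alloc i xpredT)).
  by move=> w; have /andP[b0 b1] := sum_alloc_bound i xpredT (bt w); rewrite ger0_norm.
exact: (integrableD measurableT vi' (integrableB measurableT hi' li')).
Qed.

Lemma L1fun_gross_utility_upd i x : in_range A i x ->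
  L1fun (fun w => gross_utility i (upd (profile A w) i x)).
Proof.
move=> ix; apply: L1fun_gross_utility.
- exact: measurable_upd_profile.
- by move=> w; apply: box_upd => //; exact: box_profile.
- by move=> j; exact: (valuation_integrable SA).
- under eq_fun do rewrite tnth_upd eqxx.
  exact: finite_measure_integrable_cst.
- under eq_fun do rewrite tnth_upd eqxx.
  exact: finite_measure_integrable_cst.
Qed.

(** A positive nondecreasing valuation is dominated by its value at the top type. This carries
    integrability from a fixed own type, where it is assumed, to the random profile. *)
Lemma valuation_profile_le i j t : box A t ->
  `|valuation A i j t| <= `|valuation A i j (upd t i (hi A i))|.
Proof.
move=> bt; rewrite !gtr0_norm; last 2 first.
- by apply: (valuation_gt0 SA); apply: box_upd => //; exact: hi_in_range.
- exact: (valuation_gt0 SA).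
rewrite -[in leLHS](upd_tnth t i).
have := valuation_nondecreasing SA j bt (bt i) (hi_in_range i); apply.
by have := bt i; rewrite /in_range in_itv => /andP[].
Qed.

Lemma L1fun_gross_utility_profile i :
  L1fun (fun w => gross_utility i (profile A w)).
Proof.
apply: L1fun_gross_utility.
- exact: measurable_profile.
- exact: box_profile.
- move=> j; have vhi := valuation_integrable SA j (hi_in_range i).
  apply: (le_integrable measurableT _ _ vhi).
  + apply/measurable_EFinP; apply: (measurable_box_comp measurable_profile box_profile).
    exact: (valuation_measurable SA).
  + by move=> w _; rewrite /= lee_fin; exact/valuation_profile_le/box_profile.
- under eq_fun do rewrite tnth_mktuple; exact: (premium_integrable SA).
- under eq_fun do rewrite tnth_mktuple; exact: (discount_integrable SA).
Qed.

End allocation.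
End model.

(** * The marginal rent and its integral over the own type *)

Section marginal.
Context d {Omega : measurableType d} {R : realType} {P : probability Omega R}
  {N M G : nat}.
Variables (A : auction P N M G) (SA : standing A).
Variables (p : allocation (R := R) (N := N) (M := M)) (c : costs) (Hpc : mechanism A p c).

Local Notation L1fun f := (P.-integrable [set: Omega] (EFin \o f)).

Definition interior_type i : set (N.-tuple R) :=
  box A `&` [set t | tnth t i \in `]lo A i, hi A i[].

Lemma measurable_interior_type i : measurable (interior_type i).
Proof.
apply: measurableI; first exact: measurable_box.
rewrite (_ : mkset _ = (@tnth N R ^~ i) @^-1` `]lo A i, hi A i[) //.
by rewrite -[X in measurable X]setTI; exact: measurable_tnth.
Qed.

Lemma dval_upd i j t y :
  dval A i j (upd t i y) = derive1 (fun z => valuation A i j (upd t i z)) y.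
Proof.
rewrite /dval tnth_upd eqxx; congr (derive1 _ y).
by apply/funext => z; rewrite upd_upd.
Qed.

Lemma dval_ge0 i j t : interior_type i t -> 0 <= dval A i j t.
Proof.
move=> [bt it]; rewrite /dval.
apply: (nondecreasing_derive1_ge0 (valuation_nondecreasing SA j bt) it).
exact: (valuation_derivable SA).
Qed.

(** A pointwise limit of difference quotients. Their increments depend measurably on [t] and keep
    the shifted own type below [hi A i], hence the profile in the box, where the valuation is
    measurable. *)
Lemma measurable_dval i j : measurable_fun (interior_type i) (dval A i j).
Proof.
pose e n (t : N.-tuple R) := eps_seq (tnth t i) (hi A i) n.
pose h n (t : N.-tuple R) :=
  (e n t)^-1 * (valuation A i j (upd t i (tnth t i + e n t)) - valuation A i j t).
have eP t : interior_type i t -> (forall n, 0 < e n t) /\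
    (forall n, tnth t i + e n t < hi A i) /\ e n t @[n --> \oo] --> 0.
  by move=> [_ /=]; rewrite in_itv/= => /andP[_ /eps_seqP].
have mi : measurable_fun (interior_type i) (@tnth N R ^~ i).
  by apply: measurable_funTS; exact: measurable_tnth.
have me n : measurable_fun (interior_type i) (e n).
  by apply: measurable_funM => //; exact: measurable_funB.
apply: (measurable_fun_cvg (h := h)) => [n|t it].
  apply: measurable_funM.
    by apply: ge0_measurable_funV => // t /eP[e0 _]; exact: ltW.
  apply: measurable_funB; last first.
    by apply: measurable_funS (valuation_measurable SA i j);
      [exact: measurable_box|move=> t []].
  apply: (measurable_comp (measurable_box A) _ (valuation_measurable SA i j)).
    move=> _ [t it <-]; have [e0 [elt _]] := eP t it.
    have [bt] := it; rewrite /= in_itv/= => /andP[lot _].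
    apply: box_upd => //; rewrite /in_range in_itv/= (ltW (elt n)) andbT.
    by rewrite ler_wpDr// ltW.
  apply/measurable_funTS; apply: measurable_upd => //.
  apply: measurable_funD; first exact: measurable_tnth.
  by apply: measurable_funM => //; apply: measurable_funB => //; exact: measurable_tnth.
have [e0 [_ ecvg]] := eP t it; have [bt it'] := it.
have := cvg_quotient (valuation_derivable SA (j := j) bt it') _ ecvg.
rewrite upd_tnth; apply.
by move=> n; rewrite gt_eqF.
Qed.

(* Cut off at the endpoints, where [dval] need not be measurable. *)
Definition marginal_rent i j : N.-tuple R -> R :=
  (fun t => dval A i j t * p i j t) \_ (interior_type i).

Lemma marginal_rent_ge0 i j t : 0 <= marginal_rent i j t.
Proof.
rewrite /marginal_rent patchE; case: ifPn => [/[!inE] it|_]; last exact: lexx.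
by rewrite mulr_ge0 ?dval_ge0//; case: it => bt _; exact: (alloc_ge0 Hpc).
Qed.

Lemma measurable_marginal_rent i j :
  measurable_fun [set: N.-tuple R] (marginal_rent i j).
Proof.
apply/(measurable_restrictT _ (measurable_interior_type i)).
apply: measurable_funM; first exact: measurable_dval.
apply: measurable_funS (alloc_measurable Hpc i j); first exact: measurable_box.
by move=> t [].
Qed.

Lemma marginal_rent_out i j t y : y \notin `]lo A i, hi A i[ ->
  marginal_rent i j (upd t i y) = 0.
Proof.
move=> yout; rewrite /marginal_rent patchE memNset// => -[_ /=].
by rewrite tnth_upd eqxx (negPf yout).
Qed.

Lemma marginal_rentE i j t y : box A t -> y \in `]lo A i, hi A i[ ->
  marginal_rent i j (upd t i y) = dval A i j (upd t i y) * p i j (upd t i y).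
Proof.
move=> bt yin; rewrite /marginal_rent patchE mem_set//; split.
  by apply: box_upd => //; exact: subset_itv_oo_cc yin.
by rewrite /= tnth_upd eqxx.
Qed.

(** The half-line is harmless because [marginal_rent] vanishes outside the type interval, and it
    matches the form of [integral_survival_pdf]. Extended values let Tonelli apply without a prior
    proof of finiteness. *)
Definition rent_below i j (x : R) (t : N.-tuple R) : \bar R :=
  (\int[@lebesgue_measure R]_(y in `]-oo, x[) (marginal_rent i j (upd t i y))%:E)%E.

Lemma measurable_marginal_rent_upd i j t :
  measurable_fun [set: R] (fun y : R => marginal_rent i j (upd t i y)).
Proof.
by apply: (measurableT_comp (measurable_marginal_rent i j)); exact: measurable_upd.
Qed.

Lemma rent_below_ge0 i j x t : (0 <= rent_below i j x t)%E.
Proof. by apply: integral_ge0 => y _; rewrite lee_fin marginal_rent_ge0. Qed.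

Lemma measurable_derive1_valuation i j t : box A t ->
  measurable_fun `]lo A i, hi A i[ (derive1 (fun y => valuation A i j (upd t i y))).
Proof.
move=> bt; rewrite (_ : derive1 _ = fun y => dval A i j (upd t i y)); last first.
  by apply/funext => y; rewrite dval_upd.
have mu : measurable_fun `]lo A i, hi A i[ (fun y : R => upd t i y).
  by apply: measurable_funTS; exact: measurable_upd.
apply: (measurable_comp (measurable_interior_type i) _ (measurable_dval j) mu).
  move=> _ [y yin <-]; split; last by rewrite /= tnth_upd eqxx.
  by apply: box_upd => //; exact: subset_itv_oo_cc yin.
Qed.

(** Shares are at most 1, so the rent is at most the integral of the derivative, hence at most the
    total increase of the valuation; positivity at the lowest type removes the subtracted term. *)
Lemma rent_below_le i j x t : box A t ->
  (rent_below i j x t <= (valuation A i j (upd t i (hi A i)))%:E)%E.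
Proof.
move=> bt; pose v y := valuation A i j (upd t i y).
apply: (@le_trans _ _ (v (hi A i) - v (lo A i))%:E); last first.
  rewrite lee_fin gerBl ltW//; apply: (valuation_gt0 SA); apply: box_upd => //.
  exact: lo_in_range.
have := integral_concave_derive1_le (valuation_concave SA j bt)
  (valuation_nondecreasing SA j bt) (valuation_derivable SA (j := j) bt)
  (measurable_derive1_valuation j bt) (lo_lt_hi SA i).
apply: le_trans; rewrite /rent_below integral_mkcond [leRHS]integral_mkcond.
have mv := measurable_derive1_valuation j bt (i := i).
have mm : measurable_fun [set: R] (fun y => (marginal_rent i j (upd t i y))%:E).
  by apply/measurable_EFinP; exact: measurable_marginal_rent_upd.
have mm' : measurable_fun [set: measurableTypeR R]
    (fun y => (marginal_rent i j (upd t i y))%:E) by exact: mm.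
have mv' : measurable_fun `]lo A i, hi A i[ (fun y => (derive1 v y)%:E).
  exact/measurable_EFinP.
apply: ge0_le_integral => //.
- move=> y _; rewrite patchE; case: ifP => // _; rewrite lee_fin; exact: marginal_rent_ge0.
- apply: (measurable_restrictT _ (measurable_itv `]-oo, x[)).1.
  exact: (measurable_funTS mm').
- exact: (measurable_restrictT _ (measurable_itv `]lo A i, hi A i[)).1.
move=> y _; rewrite !patchE.
have [yin|yout] := boolP (y \in `]lo A i, hi A i[).
  rewrite [y \in `]lo A i, _[%classic]mem_set// -dval_upd.
  have by_ : interior_type i (upd t i y).
    split; last by rewrite /= tnth_upd eqxx.
    by apply: box_upd => //; exact: subset_itv_oo_cc yin.
  case: ifP => _; rewrite lee_fin ?dval_ge0// marginal_rentE//.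
  rewrite ler_piMr ?dval_ge0//; apply: (alloc_le1_each Hpc).
  by case: by_.
rewrite [y \in `]lo A i, _[%classic]memNset; last by move=> /= yi; rewrite yi in yout.
by case: ifP => // _; rewrite marginal_rent_out.
Qed.

Lemma rent_below_fin i j x t : box A t -> rent_below i j x t \is a fin_num.
Proof.
move=> bt; rewrite ge0_fin_numE ?rent_below_ge0//.
exact: le_lt_trans (rent_below_le i j x bt) (ltry _).
Qed.

(** The two integrands, extended by 0 to the whole line, can differ only at [lo A i] and [x], which
    form a Lebesgue null set. *)
Lemma rent_lo i t x : box A t -> in_range A i x ->
  rent A p i (lo A i) x t = \sum_(j < M) fine (rent_below i j x t).
Proof.
move=> bt; rewrite /in_range in_itv/= => /andP[lox xhi].
apply: eq_bigr => j _; rewrite /oint lox /Rintegral; congr fine.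
rewrite integral_mkcond [RHS]integral_mkcond.
apply: (@eq_integral_off_null _ (measurableTypeR R) R lebesgue_measure
  [set lo A i; x] setT).
- by apply: measurableU.
- by apply: countable_lebesgue_measure0; exact: finite_set_countable.
move=> y yN; rewrite !patchE.
have ylo : y != lo A i by apply/eqP => e; apply: yN; left.
have yx : y != x by apply/eqP => e; apply: yN; right.
have [yin|yout] := boolP (y \in `[lo A i, x]).
  rewrite mem_set//; move: yin; rewrite in_itv/= => /andP[ly yx'].
  have {}yx' : y < x by rewrite lt_neqAle yx.
  rewrite mem_set; last by rewrite /= in_itv.
  rewrite marginal_rentE// in_itv/= lt_neqAle eq_sym ylo ly/=.
  exact: lt_le_trans xhi.
rewrite memNset; last by move=> /= yi; rewrite yi in yout.
case: ifP => // /[1!inE]/=; rewrite in_itv/= => yx'.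
rewrite marginal_rent_out//; apply/negP; rewrite in_itv/= => /andP[ly _].
by move: yout; rewrite in_itv/= (ltW ly) (ltW yx').
Qed.

End marginal.

(** * Expected rents and the inverse hazard rate *)

Section expected_rent.
Context d {Omega : measurableType d} {R : realType} {P : probability Omega R}
  {N M G : nat}.
Variables (A : auction P N M G) (SA : standing A).
Variables (p : allocation (R := R) (N := N) (M := M)) (c : costs) (Hpc : mechanism A p c).
Variable i : 'I_N.

Local Notation L1fun f := (P.-integrable [set: Omega] (EFin \o f)).

Lemma rent_below_upd j x y t :
  rent_below A p i j x (upd t i y) = rent_below A p i j x t.
Proof. by apply: eq_integral => z _; rewrite upd_upd. Qed.

Lemma measurable_marginal_rent_profile j :
  measurable_fun [set: Omega * measurableTypeR R]
    (fun z => (marginal_rent A p i j (upd (profile A z.1) i z.2))%:E).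
Proof.
have mu : measurable_fun [set: Omega * measurableTypeR R]
    (fun z => upd (profile A z.1) i z.2).
  apply: measurable_upd; last exact: measurable_snd.
  exact: (measurableT_comp (measurable_profile A) measurable_fst).
have := measurableT_comp (measurable_marginal_rent SA Hpc i j) mu.
by move=> h; apply/measurable_EFinP; exact: h.
Qed.

(** The contribution of one resource to the function [m] of the opening comment. *)
Definition mean_marginal_rent j (y : R) : \bar R :=
  (\int[P]_w (marginal_rent A p i j (upd (profile A w) i y))%:E)%E.

Lemma mean_marginal_rent_ge0 j y : (0 <= mean_marginal_rent j y)%E.
Proof. by apply: integral_ge0 => w _; rewrite lee_fin; exact: (marginal_rent_ge0 SA Hpc). Qed.

Lemma measurable_mean_marginal_rent j :
  measurable_fun [set: R] (mean_marginal_rent j).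
Proof.
apply: (measurable_fun_fubini_tonelli_G _ (measurable_marginal_rent_profile j)) => z.
by rewrite lee_fin; exact: (marginal_rent_ge0 SA Hpc).
Qed.

Lemma mean_marginal_rent_out j y : y \notin `]lo A i, hi A i[ ->
  mean_marginal_rent j y = 0%E.
Proof.
move=> yout; rewrite /mean_marginal_rent integral0_eq// => w _.
by rewrite marginal_rent_out.
Qed.

(** Tonelli exchanges the expectation over profiles with the integral over own types. *)
Lemma mean_rent_below j x :
  measurable_fun [set: Omega] (fun w => rent_below A p i j x (profile A w)) /\
  (\int[P]_w rent_below A p i j x (profile A w) =
   \int[@lebesgue_measure R]_(y in `]-oo, x[) mean_marginal_rent j y)%E.
Proof.
(* Restricting the integrand to [B] absorbs the half-line, so that Tonelli is applied on the whole
   product. *)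
pose B : set (Omega * measurableTypeR R) := [set: Omega] `*` `]-oo, x[%classic.
pose f := (fun z : Omega * measurableTypeR R =>
  (marginal_rent A p i j (upd (profile A z.1) i z.2))%:E) \_ B.
have mB : measurable B by apply: measurableX => //; exact: measurable_itv.
have mf : measurable_fun [set: Omega * measurableTypeR R] f.
  apply/(measurable_restrictT _ mB); apply: measurable_funTS.
  exact: measurable_marginal_rent_profile.
have f0 z : (0 <= f z)%E.
  rewrite /f patchE; case: ifP => // _; rewrite lee_fin.
  exact: (marginal_rent_ge0 SA Hpc).
have fE w y : f (w, y) =
    if y \in `]-oo, x[%classic then (marginal_rent A p i j (upd (profile A w) i y))%:E else 0%E.
  rewrite /f patchE (_ : ((w, y) \in B) = (y \in `]-oo, x[%classic))//.
  by apply/idP/idP; rewrite !inE /B/=; [case|].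
have rE : (fun w => rent_below A p i j x (profile A w)) =
    (fun w => \int[@lebesgue_measure R]_y f (w, y))%E.
  apply/funext => w; rewrite /rent_below integral_mkcond.
  by apply: eq_integral => y _; rewrite fE patchE.
rewrite rE; split; first exact: measurable_fun_fubini_tonelli_F.
rewrite fubini_tonelli// [RHS]integral_mkcond; apply: eq_integral => y _.
rewrite patchE; under eq_integral do rewrite fE.
by case: ifP => // _; rewrite integral0.
Qed.

Definition mean_rent j (x : R) : R :=
  Ex P (fun w => fine (rent_below A p i j x (profile A w))).

Lemma L1fun_rent_below j x :
  L1fun (fun w => fine (rent_below A p i j x (profile A w))).
Proof.
have vhi := valuation_integrable SA j (hi_in_range SA i).
apply: (le_integrable measurableT _ _ vhi).
  apply/measurable_EFinP; apply: measurableT_comp => //.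
  exact: (mean_rent_below j x).1.
move=> w _ /=; have bw := box_profile SA w.
have rf := rent_below_fin SA Hpc i j x bw.
rewrite lee_fin -lee_fin ger0_norm; last exact/fine_ge0/(rent_below_ge0 SA Hpc).
rewrite fineK// (le_trans (rent_below_le SA Hpc i j x bw))// lee_fin.
exact: ler_norm.
Qed.

Lemma mean_rentE j x : (mean_rent j x)%:E =
  (\int[@lebesgue_measure R]_(y in `]-oo, x[) mean_marginal_rent j y)%E.
Proof.
rewrite -(mean_rent_below j x).2 EFin_Ex; last exact: L1fun_rent_below.
apply: eq_integral => w _; rewrite fineK//.
exact/(rent_below_fin SA Hpc)/box_profile.
Qed.

Lemma mean_rent_ge0 j x : 0 <= mean_rent j x.
Proof.
by rewrite -lee_fin mean_rentE integral_ge0// => y _; exact: mean_marginal_rent_ge0.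
Qed.

(** The bound does not depend on [x]; this makes the mean rent integrable when the own type is
    random. *)
Lemma mean_rent_le j x :
  mean_rent j x <= Ex P (fun w => valuation A i j (upd (profile A w) i (hi A i))).
Proof.
have vhi := valuation_integrable SA j (hi_in_range SA i).
rewrite -lee_fin !EFin_Ex//; last exact: L1fun_rent_below.
apply: ge0_le_integral => //.
- move=> w _; rewrite lee_fin; exact/fine_ge0/(rent_below_ge0 SA Hpc).
- exact: measurable_int (L1fun_rent_below j x).
- have := measurable_int _ vhi; exact.
- move=> w _; rewrite fineK ?(rent_below_fin SA Hpc)//; last exact: box_profile.
  by apply: (rent_below_le SA Hpc); exact: box_profile.
Qed.

(** The correction subtracted in the virtual surplus, with the inverse hazard rate as first factor.
    Using the cut-off [marginal_rent] makes it measurable on all tuples. *)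
Definition hazard_rent j (t : N.-tuple R) : R :=
  (1 - type_cdf A i (tnth t i)) / pdf A i (tnth t i) * marginal_rent A p i j t.

Lemma measurable_hazard_rent j : measurable_fun [set: N.-tuple R] (hazard_rent j).
Proof.
have [mpdf pdf0 _] := type_pdf SA i.
have mi : measurable_fun [set: N.-tuple R] (@tnth N R ^~ i) by exact: measurable_tnth.
apply: measurable_funM; last exact: (measurable_marginal_rent SA Hpc).
apply: measurable_funM.
  apply: measurable_funB => //; apply: (measurableT_comp _ mi).
  by apply: measurableT_comp => //; exact: cdf_measurable.
apply: ge0_measurable_funV => [|t _]; last exact: pdf0.
exact: (measurableT_comp mpdf mi).
Qed.

Lemma hazard_ge0 x : 0 <= (1 - type_cdf A i x) / pdf A i x.
Proof.
have [_ pdf0 _] := type_pdf SA i.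
by apply: divr_ge0 => //; rewrite -lee_fin -cdf_compl measure_ge0.
Qed.

Lemma hazard_rent_ge0 j t : 0 <= hazard_rent j t.
Proof. by rewrite mulr_ge0 ?hazard_ge0//; exact: (marginal_rent_ge0 SA Hpc). Qed.

(** Integrability holds by boundedness. The survival formula turns the integral of the mean rent
    into that of the inverse hazard rate times [mean_marginal_rent], and resampling reads the latter
    as one expectation over profiles. *)
Lemma L1fun_mean_rent j : L1fun (fun w => mean_rent j (type_rv A i w)) /\
  (\int[P]_w (mean_rent j (type_rv A i w))%:E =
   \int[P]_w (hazard_rent j (profile A w))%:E)%E.
Proof.
have [mr rE] := integral_survival_pdf (type_pdf SA i) (pdf_gt0 SA (i := i))
  (measurable_mean_marginal_rent j) (mean_marginal_rent_ge0 j)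
  (fun y => mean_marginal_rent_out j (y := y)).
have eqE : (fun w => (mean_rent j (type_rv A i w))%:E) = (fun w =>
    \int[@lebesgue_measure R]_(y in `]-oo, type_rv A i w[) mean_marginal_rent j y)%E.
  by apply/funext => w; rewrite mean_rentE.
split.
  pose V := Ex P (fun w => valuation A i j (upd (profile A w) i (hi A i))).
  apply: (le_integrable measurableT _ _ (finite_measure_integrable_cst P V measurableT)).
    by rewrite -eqE in mr.
  move=> w _ /=; rewrite lee_fin !ger0_norm ?mean_rent_ge0 ?mean_rent_le//.
  (* The point 0 is arbitrary: the mean rent at any point shows that [V] is nonnegative. *)
  exact: le_trans (mean_rent_ge0 _ 0) (mean_rent_le _ _).
rewrite eqE rE.
have mh : measurable_fun [set: N.-tuple R] (EFin \o hazard_rent j).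
  by apply/measurable_EFinP; exact: measurable_hazard_rent.
have := ge0_integral2_resample (type_indep SA) i mh (fun t => _).
move=> -> //; last by move=> t; rewrite lee_fin hazard_rent_ge0.
(* The inverse hazard rate depends on the own type alone and leaves the inner expectation. *)
apply: eq_integral => w _ /=.
rewrite -ge0_integralZl//.
- apply: eq_integral => w' _; rewrite /hazard_rent tnth_upd eqxx EFinM//.
- apply/measurable_EFinP; apply: (measurableT_comp (measurable_marginal_rent SA Hpc i j)).
  exact: measurable_upd_profile.
- by move=> w' _; rewrite lee_fin; exact: (marginal_rent_ge0 SA Hpc).
- by rewrite lee_fin hazard_ge0.
Qed.

End expected_rent.

(** * Revenue *)

Section revenue.
Context d {Omega : measurableType d} {R : realType} {P : probability Omega R}
  {N M G : nat}.
Variables (A : auction P N M G) (SA : standing A).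

Local Notation L1fun f := (P.-integrable [set: Omega] (EFin \o f)).

Section allocation.
Variables (p : allocation (R := R) (N := N) (M := M)) (c0 : costs) (Hp : mechanism A p c0).
Variable i : 'I_N.

Let gross x := Ex P (fun w => gross_utility A p i (upd (profile A w) i x)).

Lemma rent_upd_profile x w : in_range A i x ->
  rent A p i (lo A i) x (upd (profile A w) i x) =
  \sum_(j < M) fine (rent_below A p i j x (profile A w)).
Proof.
move=> ix; rewrite rent_lo//.
  by apply: eq_bigr => j _; rewrite rent_below_upd.
by apply: box_upd => //; exact: box_profile.
Qed.

Lemma Eothers_rent x : in_range A i x ->
  Eothers A i x (rent A p i (lo A i) x) = \sum_(j < M) mean_rent A p i j x.
Proof.
move=> ix; rewrite -Ex_sum; last by move=> j; exact: (L1fun_rent_below SA Hp).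
by congr Ex; apply/funext => w; exact: rent_upd_profile.
Qed.

Lemma optimal_costE x : in_range A i x ->
  optimal_cost A p i x = gross x - Eothers A i x (rent A p i (lo A i) x).
Proof.
move=> ix; rewrite -ExB; last 2 first.
- exact: (L1fun_gross_utility_upd SA Hp).
- under eq_fun do rewrite rent_upd_profile//.
  by apply: L1fun_sum => j; exact: (L1fun_rent_below SA Hp).
by congr Ex; apply/funext => w; rewrite /= /gross_utility addrAC.
Qed.

Lemma utilityE c x : utility A p c i x = gross x - c i x.
Proof. by []. Qed.

Lemma mean_rent_lo j : mean_rent A p i j (lo A i) = 0.
Proof.
apply/EFin_inj; rewrite (mean_rentE SA Hp) integral0_eq// => y /=.
rewrite in_itv/= => ylo; apply: mean_marginal_rent_out.
by rewrite in_itv/= ltNge (ltW ylo).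
Qed.

Lemma utility_optimal_cost x : in_range A i x ->
  utility A p (optimal_cost A p) i x = Eothers A i x (rent A p i (lo A i) x).
Proof. by move=> ix; rewrite utilityE optimal_costE// subKr. Qed.

(** The lowest type earns no rent, so its participation constraint binds. *)
Lemma utility_optimal_cost_lo : utility A p (optimal_cost A p) i (lo A i) = 0.
Proof.
rewrite utility_optimal_cost ?Eothers_rent; [|exact: lo_in_range SA i..].
by apply: big1 => j _; exact: mean_rent_lo.
Qed.

(** Resampling at user [i]: averaging first over the others and then over the own type gives the
    expectation over the whole profile. *)
Lemma profile_mean_gross : L1fun (fun w => gross (type_rv A i w)) /\
  Ex P (fun w => gross (type_rv A i w)) =
  Ex P (fun w => gross_utility A p i (profile A w)).
Proof.
(* Gross utility is known to be measurable only on the box, which contains every profile; extension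
   by 0 makes it measurable everywhere. *)
pose g := (gross_utility A p i) \_ (box A).
have gE t : box A t -> g t = gross_utility A p i t.
  by move=> bt; rewrite /g patchE mem_set.
have mg : measurable_fun [set: N.-tuple R] g.
  apply/(measurable_restrictT _ (measurable_box A)).
  exact: (measurable_gross_utility SA Hp i).
have gprof : (fun w => g (profile A w)) = (fun w => gross_utility A p i (profile A w)).
  by apply/funext => w; rewrite gE//; exact: box_profile.
have ig : L1fun (fun w => g (profile A w)).
  by rewrite gprof; exact: (L1fun_gross_utility_profile SA Hp).
have grE w : (gross (type_rv A i w))%:E =
    (\int[P]_w' (g (upd (profile A w') i (type_rv A i w)))%:E)%E.
  have ix := type_in_range SA i w.
  rewrite /gross EFin_Ex; last exact: (L1fun_gross_utility_upd SA Hp).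
  by apply: eq_integral => w' _; rewrite gE//; apply: box_upd => //; exact: box_profile.
have [i1 e1] := integral_resample (type_indep SA) i mg ig.
have grE' : EFin \o (fun w => gross (type_rv A i w)) =
    (fun w => (\int[P]_w' (g (upd (profile A w') i (type_rv A i w)))%:E))%E.
  by apply/funext => w; exact: grE.
have ig' : L1fun (fun w => gross (type_rv A i w)) by rewrite grE'.
split=> //; apply/EFin_inj; rewrite EFin_Ex// EFin_Ex; last by rewrite -gprof.
transitivity (\int[P]_w (g (profile A w))%:E)%E.
  by rewrite [RHS]e1; apply: eq_integral => w _; exact: grE.
by apply: eq_integral => w _; rewrite gE//; exact: box_profile.
Qed.

(** The inverse hazard rate may be unbounded, so integrability comes from the equality of integrals
    with the bounded mean rent. *)
Lemma L1fun_hazard_rent j : L1fun (fun w => hazard_rent A p i j (profile A w)).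
Proof.
have [i1 e1] := L1fun_mean_rent SA Hp i j.
apply/integrableP; split.
  apply/measurable_EFinP; apply: (measurableT_comp (measurable_hazard_rent SA Hp i j)).
  exact: measurable_profile.
under eq_integral do rewrite /= ger0_norm ?(hazard_rent_ge0 SA Hp)//.
rewrite -e1; have /integrable_fin_num := i1.
by move=> /(_ measurableT) /fin_numPlt /andP[].
Qed.

Lemma Ex_mean_rent j : Ex P (fun w => mean_rent A p i j (type_rv A i w)) =
  Ex P (fun w => hazard_rent A p i j (profile A w)).
Proof.
have [i1 e1] := L1fun_mean_rent SA Hp i j.
by apply/EFin_inj; rewrite !EFin_Ex//; exact: L1fun_hazard_rent.
Qed.

(** A law with a density has no atoms. *)
Lemma null_endpoints : P (type_rv A i @^-1` [set lo A i; hi A i]) = 0%E.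
Proof.
have [mf _ Xf] := type_pdf SA i.
have m2 : measurable [set lo A i; hi A i] by exact: measurableU.
rewrite -[LHS]/(distribution P (type_rv A i) _) Xf//.
rewrite null_set_integral//.
- by apply/measurable_EFinP; exact: measurable_funTS.
- by apply: countable_lebesgue_measure0; exact: finite_set_countable.
Qed.

(** The integrands agree unless the type of user [i] is an endpoint. Since [dval] is uncontrolled
    there, the left integrand need not be measurable, which is why [eq_integral_off_null] is
    used. *)
Lemma Et_virtual_surplus :
  Et A (fun t => (\sum_(j < M) (valuation A i j t
       - (1 - type_cdf A i (tnth t i)) / pdf A i (tnth t i) * dval A i j t) * p i j t)
    + premium_discount A p i t) =
  Ex P (fun w => gross_utility A p i (profile A w)
     - \sum_(j < M) hazard_rent A p i j (profile A w)).
Proof.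
rewrite /Et !ExE; congr fine.
apply: (eq_integral_off_null _ _ null_endpoints).
  rewrite -[X in measurable X]setTI; apply: measurable_funP => //.
  exact: measurableU.
move=> w wN; congr EFin; rewrite /gross_utility addrAC -sumrB; congr (_ + _).
apply: eq_bigr => j _; rewrite /hazard_rent -[in marginal_rent _ _ _ _ _](upd_tnth (profile A w) i).
rewrite (marginal_rentE p j (box_profile SA w)) ?upd_tnth; first by ring.
rewrite tnth_mktuple; have := type_in_range SA i w.
rewrite /in_range !in_itv/= !lt_neqAle => /andP[-> ->]; rewrite !andbT.
by apply/andP; split; apply/eqP => e; apply: wN; [left|right].
Qed.

(** Revenue equivalence for one user: the expected cost is mean gross utility minus mean rent,
    rewritten by [profile_mean_gross] and [Ex_mean_rent] respectively. *)
Lemma Eown_optimal_cost : Eown A i (optimal_cost A p i) =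
  Et A (fun t => (\sum_(j < M) (valuation A i j t
       - (1 - type_cdf A i (tnth t i)) / pdf A i (tnth t i) * dval A i j t) * p i j t)
    + premium_discount A p i t).
Proof.
have [ig eg] := profile_mean_gross.
have im j := (L1fun_mean_rent SA Hp i j).1.
have ih := L1fun_hazard_rent.
rewrite Et_virtual_surplus /Eown.
have -> : (fun w => optimal_cost A p i (type_rv A i w)) =
    (fun w => gross (type_rv A i w)) \-
    (fun w => \sum_(j < M) mean_rent A p i j (type_rv A i w)).
  apply/funext => w; have ix := type_in_range SA i w.
  by rewrite optimal_costE// Eothers_rent.
rewrite !ExB//; [|exact: (L1fun_gross_utility_profile SA Hp)|exact: L1fun_sum..].
by rewrite !Ex_sum// eg; congr (_ - _); apply: eq_bigr => j _; exact: Ex_mean_rent.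
Qed.

End allocation.

(** * Feasible costs compared with the optimal cost *)

Lemma feasible_cost p c : feasible A p c -> forall i x, in_range A i x ->
  c i x = optimal_cost A p i x - utility A p c i (lo A i).
Proof.
move=> [Hm _ env _] i x ix; rewrite (optimal_costE Hm)//.
have := env i x ix; rewrite [in LHS]utilityE; lra.
Qed.

Lemma cost_le_optimal_cost p c : feasible A p c -> forall i x, in_range A i x ->
  c i x <= optimal_cost A p i x.
Proof.
move=> Fpc i x ix; rewrite (feasible_cost Fpc)// gerBl.
exact: (feasible_participation Fpc).
Qed.

(** On the range of types the optimal cost exceeds the integrable cost [c i] by a constant, the
    utility of the lowest type. *)
Lemma L1fun_optimal_cost p c i : feasible A p c ->
  L1fun (fun w => optimal_cost A p i (type_rv A i w)).
Proof.
move=> Fpc.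
rewrite (_ : (fun w => _) = (fun w => c i (type_rv A i w)) \+
    (fun=> utility A p c i (lo A i))); last first.
  apply/funext => w /=; rewrite (feasible_cost Fpc) ?subrK//.
  exact: (type_in_range SA).
exact: (integrableD measurableT (cost_integrable (feasible_mechanism Fpc) i)
  (finite_measure_integrable_cst P _ measurableT)).
Qed.

Lemma feasible_optimal_cost p c : feasible A p c -> feasible A p (optimal_cost A p).
Proof.
move=> Fpc; have [Hm _ _ truth] := Fpc; split=> //.
- by case: Hm => *; split=> // i; exact: L1fun_optimal_cost Fpc.
- by move=> i; rewrite (utility_optimal_cost_lo Hm).
- by move=> i x ix; rewrite (utility_optimal_cost_lo Hm) add0r (utility_optimal_cost Hm).
Qed.

Lemma revenue_optimal_cost p c : feasible A p c ->
  revenue A (optimal_cost A p) = virtual_surplus A p.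
Proof.
move=> Fpc; apply: eq_bigr => i _.
exact: (Eown_optimal_cost (feasible_mechanism Fpc)).
Qed.

Lemma revenue_le_optimal_cost p c : feasible A p c ->
  revenue A c <= revenue A (optimal_cost A p).
Proof.
move=> Fpc; apply: ler_sum => i _.
have ic := cost_integrable (feasible_mechanism Fpc) i.
have io := L1fun_optimal_cost i Fpc.
rewrite -lee_fin /Eown !EFin_Ex//; apply: le_integral => // w _.
by rewrite lee_fin; apply: (cost_le_optimal_cost Fpc); exact: (type_in_range SA).
Qed.

End revenue.

Theorem proposition2 (d : measure_display) (Omega : measurableType d)
    (R : realType) (P : probability Omega R) (N M G : nat)
    (A : auction P N M G) (p : allocation (R := R) (N := N) (M := M)) :
  standing A ->
  maximizes_virtual_surplus A p ->
  optimal A p (optimal_cost A p)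
  /\ (forall c, feasible A p c ->
        forall i x, in_range A i x -> c i x <= optimal_cost A p i x).
Proof.
move=> SA [[c Fpc] pmax]; split; last exact: cost_le_optimal_cost.
split=> [|p' c' Fpc']; first exact: feasible_optimal_cost Fpc.
(* The revenue of [c'] is at most that of the optimal cost for [p'], which is the virtual surplus of
   [p'], hence at most that of [p]. *)
rewrite (revenue_optimal_cost SA Fpc) (le_trans (revenue_le_optimal_cost SA Fpc'))//.
by rewrite (revenue_optimal_cost SA Fpc'); exact: pmax Fpc'.
Qed.
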